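(* Let $(X,f,x_0)$ be a minimal counting system and let $\#$ be the unique iterator for $(X,f,x_0)$. The following statements are equivalent: (1) $(X,f,x_0)$ is standard (and thus a Dedekind system). (2) The iterator $\#$ is complete. (3) Each finite set is $\#$-regular. (4) $\#_{\mathcal{P}}(A) \ne X$ for each finite set $A$. (5) The set $X$ is not finite.
   Context: For a set $A$ let $\mathcal{P}(A)$ denote its power set. A subset $\mathcal{K} \subset \mathcal{P}(A)$ is an inductive system in $\mathcal{P}(A)$ if $\varnothing \in \mathcal{K}$ and $B \cup \{a\} \in \mathcal{K}$ for all $B \in \mathcal{K}$ and $a \in A \setminus B$. A set $A$ is finite if $\mathcal{P}(A)$ itself is the only inductive system in $\mathcal{P}(A)$. Write $A \approx B$ if there exists a bijective mapping $h : A \to B$. Sets are those of ordinary set theory; in particular for every set $A$ there is an element not in $A$. A counting system is a triple $(X,f,x_0)$ with $X$ a set, $f : X \to X$ a mapping and $x_0 \in X$. A subset $Y \subset X$ is $f$-invariant if $f(Y) \subset Y$. The counting system is minimal if the only $f$-invariant subset of $X$ containing $x_0$ is $X$ itself; it is standard if $f$ is injective and $f(x) \ne x_0$ for all $x \in X$; it is a Dedekind system if it is both minimal and standard. An iterator for $(X,f,x_0)$ is an assignment $A \mapsto \#(A)$ of an element of $X$ to each finite set $A$ such that $\#(\varnothing) = x_0$ and $\#(A \cup \{a\}) = f(\#(A))$ whenever $A$ is a finite set and $a \notin A$. Each counting system has a unique iterator. The iterator $\#$ is complete if $B \approx A$ whenever $A$ and $B$ are finite sets with $\#(B) = \#(A)$.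 For each finite set $A$ put $\#_{\mathcal{P}}(A) = \{ x \in X : x = \#(C) \text{ for some } C \subset A \}$. A finite set $A$ is $\#$-regular if $\#(B) \ne \#(A)$ for each proper subset $B$ of $A$. *)

(* Defs.v *)
From mathcomp Require Import all_boot all_classical.

Set Implicit Arguments.
Unset Strict Implicit.
Unset Printing Implicit Defensive.

Local Open Scope classical_set_scope.

(* A "set" of ordinary set theory is a subset [A : set T] of an arbitrary type
   [T].  Every statement about all sets ranges over all types [T]; in a fixed
   ambient type a set need not have an element outside it, but it acquires one
   when transported to a larger type such as [option T]. *)

Section InductiveSystems.
Variable T : Type.

Definition powerset (A : set T) : set (set T) := [set B | B `<=` A].

Definition inductive_system (A : set T) (K : set (set T)) : Prop :=
  [/\ K `<=` powerset A,
      K set0 &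
      forall (B : set T) (a : T), K B -> (A `\` B) a -> K (B `|` [set a])].

(* Deliberately not [finite_set], which is defined through [nat]. *)
Definition is_finite (A : set T) : Prop :=
  forall K : set (set T), inductive_system A K -> K = powerset A.

End InductiveSystems.

Section CountingSystems.
Variables (X : Type) (f : X -> X) (x0 : X).

Definition invariant_set (Y : set X) : Prop := f @` Y `<=` Y.

Definition minimal : Prop :=
  forall Y : set X, invariant_set Y -> Y x0 -> Y = [set: X].

Definition standard : Prop := injective f /\ (forall x : X, f x <> x0).

End CountingSystems.

(* Total for convenience: the values at sets that are not finite are junk, which
   [is_iterator] does not constrain.  [num_powerset] and [regular] are meant for
   finite [A], whose subsets are again finite. *)
Definition assignment (X : Type) : Type := forall T : Type, set T -> X.

Section Iterators.
Variables (X : Type) (f : X -> X) (x0 : X) (num : assignment X).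

Definition is_iterator : Prop :=
  (forall T : Type, num (@set0 T) = x0) /\
  (forall (T : Type) (A : set T) (a : T),
     is_finite A -> ~ A a -> num (A `|` [set a]) = f (num A)).

(* [B #= A] is a bijection between the subtypes carried by [B] and [A]; asking
   for a map between the ambient types instead would separate two empty sets
   when one of those types is empty and the other is not. *)
Definition complete : Prop :=
  forall (T U : Type) (A : set T) (B : set U),
    is_finite A -> is_finite B -> num B = num A -> (B #= A)%card.

Definition num_powerset (T : Type) (A : set T) : set X :=
  [set x | exists2 C : set T, C `<=` A & x = num C].

Definition regular (T : Type) (A : set T) : Prop :=
  forall B : set T, B `<` A -> num B <> num A.

End Iterators.

(* Main.v *)
Require Import Defs.
From mathcomp Require Import all_boot all_classical.

(** Finiteness in the sense of inductive systems agrees with [finite_set], and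
    an iterator sends every set of [n] elements to the [n]-th iterate of [f] at
    [x0]; by minimality these iterates exhaust [X].  Each of the five statements
    then expresses that [n |-> iter n f x0] is injective: a coincidence between
    the [i]-th and [j]-th iterates with [i < j] makes the first [j] iterates
    invariant, hence all of [X]. *)

Local Open Scope classical_set_scope.

Lemma card_II_setU1 (T : Type) (A : set T) (a : T) (n : nat) :
  ~ A a -> (A #= `I_n)%card -> (A `|` [set a] #= `I_n.+1)%card.
Proof.
move=> Aa An; apply/eq_cardSP; exists a; first by right.
by rewrite setDUl setDv setU0 not_setD1.
Qed.

(** A point [a] of [A] missing from [B] can be added to [B] without leaving [A], which forces
    [m.+1 <= n]. *)
Lemma card_II_proper (T : Type) (A B : set T) (n : nat) :
  B `<` A -> (A #= `I_n)%card -> exists2 m, m < n & (B #= `I_m)%card.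
Proof.
move=> [BA /nonsubset[a [Aa Ba]]] An.
have /finite_setP[m Bm] : finite_set B.
  by apply: sub_finite_set BA _; apply/finite_setP; exists n.
exists m => //; rewrite -card_le_II.
have BaA : B `|` [set a] `<=` A by move=> x [/BA|->].
rewrite -(card_le_eql (card_II_setU1 _ _ _ _ Ba Bm)) -(card_le_eqr An).
exact: subset_card_le.
Qed.

(** The finite subsets of [A] form an inductive system, which must then contain [A] itself.
    Conversely, an inductive system reaches every subset of a finite [A] by adding one point at a
    time. *)
Lemma is_finiteE (T : Type) (A : set T) : is_finite A <-> finite_set A.
Proof.
split=> [Afin|/finite_setP[n An] K [KA K0 KS]].
  pose K := [set B | B `<=` A /\ finite_set B].
  suff KA : K = Defs.powerset A by have : Defs.powerset A A by []; rewrite -KA => -[].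
  apply: Afin; split=> [B []//||B a [BA Bfin] [Aa _]].
    by split; [exact: sub0set|exact: finite_set0].
  split; first by move=> x [/BA|->].
  by rewrite finite_setU; split=> //; exact: finite_set1.
rewrite eqEsubset; split=> // B BA.
have /finite_setP[m Bm] : finite_set B.
  by apply: sub_finite_set BA _; apply/finite_setP; exists n.
elim: m B BA Bm => [B _|m IHm B BA /eq_cardSP[a Ba Bm]].
  by rewrite II0 card_eq0 => /eqP ->.
rewrite -(setD1K Ba) setUC; apply: KS; last by split; [exact: BA|case=> _ /=].
by apply: IHm => // x [/BA].
Qed.

Lemma is_finite_II (n : nat) : is_finite `I_n.
Proof. by apply/is_finiteE; exact: finite_II. Qed.

(** A finite set is never equinumerous with a proper subset of itself. *)
Lemma complete_regular (X : Type) (num : assignment X) : complete num ->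
  forall (T : Type) (A : set T), is_finite A -> regular num A.
Proof.
move=> num_complete T A Afin B BA numBA.
have /is_finiteE/finite_setP[n An] := Afin.
have [m mn Bm] := card_II_proper _ _ _ _ BA An.
have Bfin : is_finite B by apply/is_finiteE/finite_setP; exists m.
have BAcard := num_complete _ _ _ _ Afin Bfin numBA.
have /card_eq_II nm : (`I_m #= `I_n)%card.
  by apply: card_eq_trans (card_eq_trans BAcard An); rewrite card_eq_sym.
by rewrite nm ltnn in mn.
Qed.

Section CountingSystem.
Variables (X : Type) (f : X -> X) (x0 : X).

Lemma minimal_iter : minimal f x0 -> forall x, exists n, iter n f x0 = x.
Proof.
move=> minX x; pose Y := [set x | exists n, iter n f x0 = x].
suff YT : Y = [set: X] by have : Y x by rewrite YT.
apply: minX; last by exists 0.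
by move=> _ [_ [n <-] <-]; exists n.+1.
Qed.

(** Injectivity cancels [f] on both sides until one index is zero; the other is then zero too, since
    [x0] is not a value of [f]. *)
Lemma standard_iter_inj : standard f x0 -> injective (fun n => iter n f x0).
Proof.
move=> [f_inj f_neq]; elim=> [|i IHi] [|j] //=.
- by move/esym/f_neq.
- by move/f_neq.
- by move/f_inj/IHi ->.
Qed.

Lemma iter_inj_standard : minimal f x0 ->
  injective (fun n => iter n f x0) -> standard f x0.
Proof.
move=> minX u_inj; split=> [x y|x].
  have [[i <-] [j <-]] := (minimal_iter minX x, minimal_iter minX y).
  by move=> /(u_inj i.+1 j.+1)[->].
by have [i <-] := minimal_iter minX x => /(u_inj i.+1 0).
Qed.

Lemma iter_collision_finite (i j : nat) : minimal f x0 ->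
  i < j -> iter i f x0 = iter j f x0 -> finite_set [set: X].
Proof.
move=> minX ij uij; pose Y := (fun n => iter n f x0) @` `I_j.
suff <- : Y = [set: X] by apply: finite_image; exact: finite_II.
apply: minX; last by exists 0 => //=; exact: leq_ltn_trans ij.
move=> _ [_ [n /= nj <-] <-].
(* The orbit could leave the first [j] iterates only at index [j], where the collision sends it back
   to index [i]. *)
move: nj; rewrite leq_eqVlt => /predU1P[nj|nj]; last by exists n.+1.
by exists i; rewrite //= uij -nj.
Qed.

Lemma infinite_standard : minimal f x0 ->
  ~ finite_set [set: X] -> standard f x0.
Proof.
move=> minX Xinf; apply: iter_inj_standard => // i j /= uij.
have [ij|ji|//] := ltngtP i j.
- by case: Xinf; exact: iter_collision_finite uij.
- by case: Xinf; exact: iter_collision_finite (esym uij).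
Qed.

Variable num : assignment X.
Hypothesis iter_num : is_iterator f x0 num.

(** Since only the number of elements matters, sets in different types can be compared, and initial
    segments of the naturals serve as representatives. *)
Lemma num_iter (T : Type) (A : set T) (n : nat) :
  (A #= `I_n)%card -> num T A = iter n f x0.
Proof.
have [num0 numS] := iter_num.
elim: n A => [A|n IHn A /eq_cardSP[a Aa An]].
  by rewrite II0 card_eq0 => /eqP ->.
rewrite -(setD1K Aa) setUC numS; first by rewrite (IHn _ An).
- by apply/is_finiteE/finite_setP; exists n.
- by case=> _ /=.
Qed.

Lemma standard_complete : standard f x0 -> complete num.
Proof.
move=> /standard_iter_inj u_inj T U A B.
move=> /is_finiteE/finite_setP[n An] /is_finiteE/finite_setP[m Bm].
rewrite (num_iter _ _ _ An) (num_iter _ _ _ Bm) => /u_inj mn.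
by rewrite mn in Bm; apply: card_eq_trans Bm _; rewrite card_eq_sym.
Qed.

Lemma regular_num_powerset :
  (forall (T : Type) (A : set T), is_finite A -> regular num A) ->
  forall (T : Type) (A : set T), is_finite A -> num_powerset num A <> [set: X].
Proof.
move=> num_regular T A /is_finiteE Afin numA.
have /finite_setP[n An] := Afin.
(* The index [n.+1] exceeds the size of every subset of [A], so reaching this iterate makes two
   different sizes share a value. *)
have [C CA numC] : num_powerset num A (iter n.+1 f x0) by rewrite numA.
have /finite_setP[m Cm] := sub_finite_set CA Afin.
have mn : m <= n.
  rewrite -card_le_II -(card_le_eql Cm) -(card_le_eqr An).
  exact: subset_card_le.
(* Regularity is applied to initial segments of the naturals rather than to [A], whose ambient type
   may have no element outside [A]. *)
apply: (num_regular _ `I_n.+1 (is_finite_II _) `I_m); last first.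
  by rewrite !(num_iter _ _ _ (card_eqxx _)) numC (num_iter _ _ _ Cm).
split=> [k /= km|nm]; first by rewrite ltnS (leq_trans (ltnW km)).
by have /= := nm n (ltnSn n); rewrite ltnNge mn.
Qed.

Lemma num_powerset_infinite : minimal f x0 ->
  (forall (T : Type) (A : set T),
     is_finite A -> num_powerset num A <> [set: X]) ->
  ~ is_finite [set: X].
Proof.
move=> minX num_pow /is_finiteE Xfin.
have [g gE] := choice (minimal_iter minX).
(* With [X] finite this is a finite set of naturals, and it contains, for each [x], a segment of
   [g x] elements, whose number is [x]. *)
pose A := \bigcup_(x in [set: X]) `I_(g x).
apply: (num_pow _ A).
  by apply/is_finiteE/bigcup_finite => // x _; exact: finite_II.
rewrite eqEsubset; split=> // x _; exists `I_(g x).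
  by move=> k kx; exists x.
by rewrite (num_iter _ _ _ (card_eqxx _)) gE.
Qed.

End CountingSystem.

Theorem theorem4p1 (X : Type) (f : X -> X) (x0 : X) (num : assignment X)
    (minX : minimal f x0) (iter_num : is_iterator f x0 num) :
  [<-> standard f x0;
       complete num;
       forall (T : Type) (A : set T), is_finite A -> regular num A;
       forall (T : Type) (A : set T), is_finite A -> num_powerset num A <> [set: X];
       ~ is_finite [set: X]].
Proof.
tfae.
- exact: standard_complete.
- exact: complete_regular.
- exact: (regular_num_powerset _ f x0).
- exact: (num_powerset_infinite _ f x0).
- by move=> Xinf; apply: infinite_standard => // /is_finiteE.
Qed.
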